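(* Let $(c_1(z),\dots,c_n(z))\in\mathbb{F}_p(z)^n$. Then $(c_1(z),\dots,c_n(z))\in\operatorname{Ann}(\mathcal{M}_{\mathbb{F}_p(z)})$ if and only if there exists a polynomial $Q(x,z)\in\mathbb{F}_p(z)[x]$ such that $$\frac{\partial Q}{\partial x}(x,z)=\sum_{j=1}^n c_j(z)\,\frac{\Phi(x,z)}{x-z_j}.$$
   Context: Let $p,q$ be prime numbers, $k$ a positive integer, $n=kq+1$, and $p>n$. Let $z=(z_1,\dots,z_n)$, and let $\mathbb{F}_p(z)=\mathbb{F}_p(z_1,\dots,z_n)$ be the field of rational functions. Let $a$ be the unique integer with $1\le a<q$ and $q\mid(ap-1)$; put $M=(ap-1)/q\in\mathbb{Z}_{>0}$. Let $\Phi(x,z)=\prod_{i=1}^n(x-z_i)^M$ over $\mathbb{F}_p$, and define vectors $P^i(z)=(P^i_1(z),\dots,P^i_n(z))\in\mathbb{F}_p[z_1,\dots,z_n]^n$ by the expansion $$\Big(\frac{\Phi(x,z)}{x-z_1},\dots,\frac{\Phi(x,z)}{x-z_n}\Big)=\sum_i P^i(z)\,x^i .$$ The vectors $P^{lp-1}(z)$, $l=1,\dots,ak$, are called arithmetic solutions, and $\mathcal{M}_{\mathbb{F}_p(z)}$ is the $\mathbb{F}_p(z)$-subspace of $\mathbb{F}_p(z)^n$ spanned by them. Its annihilator is $$\operatorname{Ann}(\mathcal{M}_{\mathbb{F}_p(z)})=\Big\{(c_1,\dots,c_n)\in\mathbb{F}_p(z)^n\ \Big|\ \sum_{j=1}^nc_j(z)P^{lp-1}_j(z)=0,\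 l=1,\dots,ak\Big\}.$$ *)

(* Defs.v *)
From HB Require Import structures.
From mathcomp Require Import all_boot all_order all_algebra.
From mathcomp Require Import mpoly.

Set Implicit Arguments.
Unset Strict Implicit.
Unset Printing Implicit Defensive.

Import GRing.Theory.
Local Open Scope ring_scope.

Notation Fpz p n := {mpoly ('F_p)[n]}.
Notation FpzFrac p n := {fraction {mpoly ('F_p)[n]}}.

(* The exponent M = (a p - 1) / q, meant for 0 < a and q dividing a p - 1. *)
Definition expM (p q a : nat) : nat := ((a * p - 1) %/ q)%N.

(* The polynomials in x have coefficients in F_p[z]; 'X is x, 'X_i is z_i. *)
Definition Phi (p n M : nat) : {poly Fpz p n} :=
  \prod_(i < n) ('X - ('X_i)%:P) ^+ M.

(* For 0 < M, the division by the monic polynomial x - z_j is exact. *)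
Definition PhiDiv (p n M : nat) (j : 'I_n) : {poly Fpz p n} :=
  (Phi p n M %/ ('X - ('X_j)%:P))%R.

(* P^i(z), a vector over F_p[z]. *)
Definition Pvec (p n M i : nat) : 'rV[Fpz p n]_n :=
  \row_j (PhiDiv p M j)`_i.

(* Ann(M_{F_p(z)}), a set of row vectors over F_p(z). *)
Definition inAnn (p q k n a : nat) (c : 'rV[FpzFrac p n]_n) : Prop :=
  forall l : nat, (1 <= l <= a * k)%N ->
    \sum_(j < n) c 0 j * tofrac (Pvec p n (expM p q a) (l * p - 1) 0 j) = 0.

(* Main.v *)
(** In characteristic [p] a polynomial has an antiderivative exactly when its
    coefficients of [x^(lp-1)], [l >= 1], vanish.  The polynomials
    [Phi/(x - z_j)] have degree less than [(ak+1)p - 1], because [a < q] gives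
    [M < p]; so only [l = 1, ..., ak] impose a condition. *)
Require Import Defs.
From HB Require Import structures.
From mathcomp Require Import all_boot all_order all_algebra.
From mathcomp Require Import mpoly.
From mathcomp Require Import zify.

Set Implicit Arguments.
Unset Strict Implicit.
Unset Printing Implicit Defensive.

Import GRing.Theory.
Local Open Scope ring_scope.

Lemma ex_antiderivative_pchar (F : fieldType) (p : nat) (f : {poly F}) :
  p \in [pchar F] ->
  (exists Q : {poly F}, Q^`() = f) <->
  (forall l : nat, (0 < l)%N -> f`_(l * p - 1) = 0).
Proof.
move=> chF; have p_gt0 : (0 < p)%N by apply/prime_gt0/(pcharf_prime chF).
split=> [[Q <-] l l_gt0|f0].
  have lp_gt0 : (0 < l * p)%N by rewrite muln_gt0 l_gt0.
  by rewrite coef_deriv subn1 prednK // mulnC mulrnA (mulrn_pchar chF) mul0rn.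
(* Termwise integration. Where [p] divides [i], division by zero yields 0; this is harmless, as for
   [i > 0] the coefficient to be recovered is 0 by [f0]. *)
exists (\poly_(i < (size f).+1) (f`_i.-1 / i%:R)).
apply/polyP=> i; rewrite coef_deriv coef_poly ltnS.
case: ltnP => [_|fi]; last by rewrite mul0rn nth_default.
have [/dvdnP[l il]|ndvd] := boolP (p %| i.+1)%N.
  have l_gt0 : (0 < l)%N by case: l il.
  have -> : i = (l * p - 1)%N by rewrite -il subn1.
  by rewrite subn1 /= prednK ?muln_gt0 ?l_gt0 // -subn1 f0 // mul0r mul0rn.
by rewrite /= -[LHS]mulr_natr divfK // -(dvdn_pcharf chF).
Qed.

Lemma pchar_FpzFrac (p n : nat) : prime p -> p \in [pchar FpzFrac p n].
Proof.
move=> p_pr; rewrite inE p_pr /=.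
have := pchar_Fp p_pr; rewrite inE => /andP[_ /eqP p0].
by rewrite -(rmorph_nat (@tofrac _)) -(rmorph_nat (@mpolyC n _)) p0 !rmorph0.
Qed.

Lemma size_Phi (p n M : nat) : size (Phi p n M) = (n * M).+1.
Proof.
rewrite /Phi size_prod => [|i _]; last by rewrite expf_neq0 // polyXsubC_eq0.
under eq_bigr => i _ do rewrite size_exp_XsubC.
by rewrite sum_nat_const card_ord; lia.
Qed.

Lemma size_PhiDiv_le (p n M : nat) (j : 'I_n) :
  (size (PhiDiv p M j) <= (n * M).+1)%N.
Proof. by rewrite -(size_Phi p n M) /PhiDiv leq_divp. Qed.

Theorem theorem3p6 (p q k n a : nat)
    (hp : prime p) (hq : prime q) (hk : (0 < k)%N)
    (hn : n = (k * q + 1)%N) (hpn : (n < p)%N)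
    (ha : (1 <= a < q)%N) (hqa : (q %| a * p - 1)%N)
    (c : 'rV[FpzFrac p n]_n) :
  inAnn q k a c <->
  exists Q : {poly FpzFrac p n},
    Q^`() = \sum_(j < n) c 0 j *: map_poly (@tofrac _) (PhiDiv p (expM p q a) j).
Proof.
set f := \sum_(j < n) _.
(* This turns [inAnn] into the vanishing of the coefficients of [f] at [l * p - 1] for
   [1 <= l <= a * k]. *)
have coef_f i :
    f`_i = \sum_(j < n) c 0 j * tofrac (Pvec p n (expM p q a) i 0 j).
  by rewrite coef_sum; apply: eq_bigr => j _; rewrite coefZ coef_map mxE.
have deg_bound : ((n * expM p q a).+1 <= (a * k).+1 * p - 1)%N.
  have [M eM] := dvdnP hqa; have q_gt0 := prime_gt0 hq.
  rewrite /expM eM mulnK //.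
  have M_lt_p : (M < p)%N by nia.
  (* From [n = k * q + 1] and [M * q = a * p - 1]. The bound then reads [M + 2 <= p + k], which
     follows from [M < p] and [0 < k]. *)
  have -> : (n * M = k * (a * p - 1) + M)%N by rewrite hn eM; nia.
  by nia.
apply: iff_trans (iff_sym (ex_antiderivative_pchar f (pchar_FpzFrac n hp))).
split=> [annc l l_gt0|f0 l /andP[l_gt0 _]]; last by rewrite -coef_f f0.
rewrite coef_f; have [l_le|l_gt] := leqP l (a * k).
  by apply: annc; rewrite l_gt0.
(* For [l > a * k] the index [l * p - 1] is at least the size of each [PhiDiv]. *)
rewrite big1 // => j _; rewrite mxE nth_default ?rmorph0 ?mulr0 //.
apply: leq_trans (size_PhiDiv_le p _ j) (leq_trans deg_bound _).
by rewrite leq_sub2r // leq_mul2r l_gt orbT.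
Qed.
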